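(* Let $\alpha\ne0$ and $\delta$ be real constants. Every $3$-$(\alpha,\delta)$-Sasaki manifold $(M,\varphi_i,\xi_i,\eta_i,g)$ is a canonical almost $3$-contact metric manifold. In particular, it admits the constant Reeb Killing function $\beta=2(\delta-2\alpha)$.
   Context: An almost contact metric structure $(\varphi,\xi,\eta,g)$ consists of a $(1,1)$-tensor field $\varphi$, a vector field $\xi$, a $1$-form $\eta$ and a Riemannian metric $g$ with $\varphi^2=-I+\eta\otimes\xi$, $\eta(\xi)=1$, $g(\varphi X,\varphi Y)=g(X,Y)-\eta(X)\eta(Y)$. Its fundamental form is $\Phi(X,Y)=g(X,\varphi Y)$, and $N_\varphi(X,Y)=[\varphi X,\varphi Y]+\varphi^2[X,Y]-\varphi[\varphi X,Y]-\varphi[X,\varphi Y]+d\eta(X,Y)\xi$, $N_\varphi(X,Y,Z)=g(N_\varphi(X,Y),Z)$. An almost $3$-contact metric manifold $(M,\varphi_i,\xi_i,\eta_i,g)$, $i=1,2,3$, is a manifold of dimension $4n+3$ with three almost contact metric structures with the same $g$ such that, for every even permutation $(i,j,k)$ of $(1,2,3)$, $\varphi_k=\varphi_i\varphi_j-\eta_j\otimes\xi_i=-\varphi_j\varphi_i+\eta_i\otimes\xi_j$, $\xi_k=\varphi_i\xi_j=-\varphi_j\xi_i$, $\eta_k=\eta_i\circ\varphi_j=-\eta_j\circ\varphi_i$. Set $\mathcal H=\bigcap_i\ker\eta_i$. It is $3$-$(\alpha,\delta)$-Sasaki if $d\eta_i=2\alpha\Phi_i+2(\alpha-\delta)\eta_j\wedge\eta_k$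 for every even permutation $(i,j,k)$ of $(1,2,3)$, with real constants $\alpha\neq0$, $\delta$. For $X,Y\in\Gamma(\mathcal H)$ let $A_{ij}(X,Y)=g((\mathcal L_{\xi_j}\varphi_i)X,Y)+d\eta_j(X,\varphi_iY)+d\eta_j(\varphi_iX,Y)$, $A_i=A_{ii}$. $M$ admits a Reeb Killing function $\beta\in C^\infty(M)$ if $A_i(X,Y)=0$ and $A_{ij}(X,Y)=-A_{ji}(X,Y)=\beta\Phi_k(X,Y)$ for all $X,Y\in\Gamma(\mathcal H)$ and every even permutation $(i,j,k)$ of $(1,2,3)$. $M$ is canonical if: 1) each $N_{\varphi_i}$ is skew-symmetric on $\mathcal H$ (i.e. $N_{\varphi_i}(X,Y,Z)$ restricted to $\mathcal H$ is a $3$-form); 2) each $\xi_i$ is Killing; 3) $N_{\varphi_i}(X,Y,Z)-d\Phi_i(\varphi_iX,\varphi_iY,\varphi_iZ)=N_{\varphi_j}(X,Y,Z)-d\Phi_j(\varphi_jX,\varphi_jY,\varphi_jZ)$ for all $X,Y,Z\in\Gamma(\mathcal H)$ and all $i,j$; 4) $M$ admits a Reeb Killing function $\beta$. Conventions: $d\eta(X,Y)=X(\eta(Y))-Y(\eta(X))-\eta([X,Y])$, $(\eta\wedge\zeta)(X,Y)=\eta(X)\zeta(Y)-\eta(Y)\zeta(X)$, and analogously (no numerical factors) in higher degree. *)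

(* Defs.v *)
From HB Require Import structures.
From mathcomp Require Import all_boot all_order all_fingroup all_algebra.
From mathcomp Require Import all_classical all_reals all_analysis.
Set Implicit Arguments.
Unset Strict Implicit.
Unset Printing Implicit Defensive.
Import Order.TTheory GRing.Theory Num.Theory.
Import numFieldNormedType.Exports.
Local Open Scope classical_set_scope.
Local Open Scope ring_scope.

Section EuclideanSmoothness.
Context {R : realType} {m : nat}.
Implicit Types (U : set 'rV[R]_m) (f g : 'rV[R]_m -> R).

Definition partial (i : 'I_m) f : 'rV[R]_m -> R :=
  fun x => 'D_(delta_mx 0 i) f x.

(* Only meaningful for open U: the partial derivatives at a point of U see f
   in a neighbourhood of that point only. *)
Fixpoint Ck (k : nat) U f : Prop :=
  {in U, continuous f} /\
  (if k is k'.+1 then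
     forall i : 'I_m, {in U, forall x, derivable f x (delta_mx 0 i)} /\
                      Ck k' U (partial i f)
   else True).

Definition Coo U f : Prop := forall k, Ck k U f.

Lemma CkW k U f : Ck k.+1 U f -> Ck k U f.
Proof.
elim: k f => [|k IH] f [fc fd]; split=> // i.
by have [fdi fk] := fd i; split=> //; exact: IH.
Qed.

Lemma Ck_eq k U f g : open U -> {in U, f =1 g} -> Ck k U f -> Ck k U g.
Proof.
move=> oU; elim: k f g => [|k IH] f g fg [fc fd].
all: have nfg x : x \in U -> {near x, f =1 g}.
1,3: by rewrite inE => Ux; apply: filterS (open_nbhs_nbhs (conj oU Ux)) => y Uy;
  apply: fg; rewrite inE.
all: have gc : {in U, continuous g}.
1,3: by move=> x xU; rewrite /continuous_at -fg //;
  exact: cvg_trans (near_eq_cvg (nfg x xU)) (fc x xU).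
all: split=> // i; have [fdi fk] := fd i; split=> [x xU|].
  by apply: near_eq_derivable (fdi x xU); exact: nfg.
by apply: IH fk => x xU; apply: near_eq_derive; exact: nfg.
Qed.

Lemma CkD k U f g : open U -> Ck k U f -> Ck k U g -> Ck k U (f \+ g).
Proof.
move=> oU; elim: k f g => [|k IH] f g [fc fd] [gc gd].
  by split=> // x xU; exact: (cvgD (fc x xU) (gc x xU)).
split=> [x xU|i]; first exact: (cvgD (fc x xU) (gc x xU)).
have [fdi fk] := fd i; have [gdi gk] := gd i; split=> [x xU|].
  by apply: derivableD; [exact: fdi|exact: gdi].
apply: Ck_eq (IH _ _ fk gk) => // x xU /=.
by rewrite /partial deriveD //; [exact: fdi|exact: gdi].
Qed.

Lemma CkM k U f g : open U -> Ck k U f -> Ck k U g -> Ck k U (f \* g).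
Proof.
move=> oU; elim: k f g => [|k IH] f g fS gS; have [fc fd] := fS;
  have [gc gd] := gS.
  by split=> // x xU; exact: (cvgM (fc x xU) (gc x xU)).
split=> [x xU|i]; first exact: (cvgM (fc x xU) (gc x xU)).
have [fdi fk] := fd i; have [gdi gk] := gd i; split=> [x xU|].
  by apply: derivableM; [exact: fdi|exact: gdi].
apply: Ck_eq (CkD oU (IH _ _ (CkW fS) gk) (IH _ _ (CkW gS) fk)) => // x xU /=.
by rewrite /partial deriveM //; [exact: fdi|exact: gdi].
Qed.

Lemma Ck_cst k U (a : R) : open U -> Ck k U (fun=> a).
Proof.
move=> oU; elim: k a => [|k IH] a.
  by split=> // x _; exact: cst_continuous.
split=> [x _|i]; first exact: cst_continuous.
split=> [x _|]; first exact: derivable_cst.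
by apply: Ck_eq (IH 0) => // x _; exact/esym/derive_cst.
Qed.

End EuclideanSmoothness.

(* A homeomorphism from an open subset of T onto an open subset of R^m;
   chart_map and chart_inv are only meaningful on chart_dom and chart_cod. *)
Record chart (R : realType) (m : nat) (T : topologicalType) := Chart {
  chart_dom : set T;
  chart_cod : set 'rV[R]_m;
  chart_map : T -> 'rV[R]_m;
  chart_inv : 'rV[R]_m -> T;
  chart_dom_open : open chart_dom;
  chart_cod_open : open chart_cod;
  chart_mapP : {homo chart_map : p / chart_dom p >-> chart_cod p};
  chart_invP : {homo chart_inv : x / chart_cod x >-> chart_dom x};
  chart_mapK : {in chart_dom, cancel chart_map chart_inv};
  chart_invK : {in chart_cod, cancel chart_inv chart_map};
  chart_map_continuous : {in chart_dom, continuous chart_map};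
  chart_inv_continuous : {in chart_cod, continuous chart_inv}
}.

Definition smooth_transition (R : realType) (m : nat) (T : topologicalType)
    (c d : chart R m T) : Prop :=
  forall i : 'I_m,
    Coo (chart_cod c `&` chart_inv c @^-1` chart_dom d)
        (fun x => chart_map d (chart_inv c x) 0 i).

Record manifold (R : realType) (m : nat) := Manifold {
  manifold_sort :> topologicalType;
  manifold_hausdorff : hausdorff_space manifold_sort;
  manifold_second_countable : @second_countable manifold_sort;
  atlas : set (chart R m manifold_sort);
  atlas_cover : forall p : manifold_sort, exists2 c, atlas c & chart_dom c p;
  atlas_smooth : forall c d, atlas c -> atlas d -> smooth_transition c d
}.

Section SmoothFunctions.
Context {R : realType} {m : nat} (M : manifold R m).

Definition is_smooth (f : M -> R) : Prop :=
  forall c, atlas c -> Coo (chart_cod c) (f \o chart_inv c).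

Definition smooth_pred : {pred M -> R} := fun f => `[< is_smooth f >].

Lemma smooth_subring : subring_closed smooth_pred.
Proof.
split.
- by apply/asboolP => c _ k; apply: Ck_cst; exact: chart_cod_open.
- move=> f g /asboolP fS /asboolP gS; apply/asboolP => c cA k.
  have oc := @chart_cod_open _ _ _ c.
  apply: Ck_eq (CkD oc (fS c cA k) (CkM oc (Ck_cst k (-1) oc) (gS c cA k))).
    exact: oc.
  by move=> x _ /=; rewrite mulN1r.
- move=> f g /asboolP fS /asboolP gS; apply/asboolP => c cA k.
  by apply: CkM; [exact: chart_cod_open|exact: fS|exact: gS].
Qed.

HB.instance Definition _ :=
  GRing.isSubringClosed.Build (M -> R) smooth_pred smooth_subring.

(* The ring of smooth functions on M, with pointwise operations. *)
Record Coo_fun := CooFun { Coo_val :> M -> R; Coo_valP : Coo_val \in smooth_pred }.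

HB.instance Definition _ := [isSub for Coo_val].
HB.instance Definition _ := [Choice of Coo_fun by <:].
HB.instance Definition _ := 
  GRing.SubChoice_isSubComPzRing.Build (M -> R) _ Coo_fun (subringClosedP _).

Lemma smooth_cst_subproof (a : R) : (fun _ : M => a) \in smooth_pred.
Proof.
by apply/asboolP => c _ k; apply: Ck_cst; exact: chart_cod_open.
Qed.

Definition smooth_cst (a : R) : Coo_fun := CooFun (smooth_cst_subproof a).

Lemma smooth_cst1 : smooth_cst 1 = 1.
Proof. exact: val_inj. Qed.

End SmoothFunctions.

Notation "''Coo' ( M )" := (Coo_fun M) (at level 8, format "''Coo' ( M )").

Section VectorFields.
Context {R : realType} {m : nat} (M : manifold R m).

Definition is_derivation (X : 'Coo(M) -> 'Coo(M)) : Prop :=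
  (forall (a : R) (f h : 'Coo(M)),
     X (smooth_cst M a * f + h) = smooth_cst M a * X f + X h) /\
  (forall f h : 'Coo(M), X (f * h) = X f * h + f * X h).

Definition derivation_pred : {pred 'Coo(M) -> ('Coo(M))^o} :=
  fun X => `[< is_derivation X >].

Lemma derivation_submod : submod_closed derivation_pred.
Proof.
split.
  by apply/asboolP; split=> [a f h|f h]; rewrite /= ?mulr0 ?mul0r ?addr0.
move=> u X Y /asboolP [Xl Xm] /asboolP [Yl Ym]; apply/asboolP.
have E f : (u *: X + Y) f = u * X f + Y f by [].
split=> [a f h|f h]; rewrite !E ?Xl ?Yl ?Xm ?Ym.
  by rewrite !mulrDr addrACA !mulrA (mulrC u (smooth_cst M a)).
by rewrite !mulrDr !mulrDl !mulrA (mulrC u f) addrACA.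
Qed.

HB.instance Definition _ :=
  GRing.isSubmodClosed.Build 'Coo(M) ('Coo(M) -> ('Coo(M))^o)
    derivation_pred derivation_submod.

(* Vector fields are the R-linear derivations of the ring of smooth functions:
   X f is the derivative of f along X. They form a module over that ring. *)
Record vector_field := VectorField {
  vector_field_val :> 'Coo(M) -> ('Coo(M))^o;
  vector_field_valP : vector_field_val \in derivation_pred
}.

HB.instance Definition _ := [isSub for vector_field_val].
HB.instance Definition _ := [Choice of vector_field by <:].
HB.instance Definition _ := [SubChoice_isSubLmodule of vector_field by <:].

Lemma lie_bracket_subproof (X Y : vector_field) :
  (fun f => X (Y f) - Y (X f)) \in derivation_pred.
Proof.
have /asboolP [Xl Xm] := vector_field_valP X.
have /asboolP [Yl Ym] := vector_field_valP Y.
have XD f h : X (f + h) = X f + X h.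
  by have := Xl 1 f h; rewrite smooth_cst1 !mul1r.
have YD f h : Y (f + h) = Y f + Y h.
  by have := Yl 1 f h; rewrite smooth_cst1 !mul1r.
apply/asboolP; split=> [a f h|f h].
  by rewrite Yl Xl Xl Yl opprD addrACA mulrBr.
rewrite Ym Xm XD YD !Xm !Ym mulrBl mulrBr !opprD.
rewrite [LHS](AC ((2*2)*(2*2)) ((1*5)*(4*8)*((2*7)*(3*6)))) /=.
by rewrite !subrr !addr0.
Qed.

Definition lie_bracket (X Y : vector_field) : vector_field :=
  VectorField (lie_bracket_subproof X Y).

End VectorFields.

Notation "''X' ( M )" := (vector_field M) (at level 8, format "''X' ( M )").

(* Tensor fields are represented by the corresponding multilinear maps over
   the ring of smooth functions. *)
Section Tensors.
Context {R : realType} {m : nat} {M : manifold R m}.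
Implicit Types (X Y Z xi : 'X(M)) (phi : {linear 'X(M) -> 'X(M)}).

(* X vanishes at p exactly when X f p = 0 for every f. *)
Record riemannian_metric := RiemannianMetric {
  metric :> 'X(M) -> 'X(M) -> 'Coo(M);
  metric_linear : forall Z, scalar (metric^~ Z);
  metric_sym : forall X Y, metric X Y = metric Y X;
  metric_pos : forall X (p : M),
    (exists f : 'Coo(M), X f p != 0) -> 0 < metric X X p
}.

(* Exterior derivative of 1-forms and 2-forms, and wedge product of 1-forms,
   without numerical factors. *)
Definition ext_d1 (eta : 'X(M) -> 'Coo(M)) X Y : 'Coo(M) :=
  X (eta Y) - Y (eta X) - eta (lie_bracket X Y).

Definition ext_d2 (w : 'X(M) -> 'X(M) -> 'Coo(M)) X Y Z : 'Coo(M) :=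
  X (w Y Z) + Y (w Z X) + Z (w X Y)
  - w (lie_bracket X Y) Z - w (lie_bracket Y Z) X - w (lie_bracket Z X) Y.

Definition wedge (eta zeta : 'X(M) -> 'Coo(M)) X Y : 'Coo(M) :=
  eta X * zeta Y - eta Y * zeta X.

Definition lie_deriv_endo xi (phi : 'X(M) -> 'X(M)) X : 'X(M) :=
  lie_bracket xi (phi X) - phi (lie_bracket xi X).

Definition lie_deriv_metric xi (g : riemannian_metric) X Y : 'Coo(M) :=
  xi (g X Y) - g (lie_bracket xi X) Y - g X (lie_bracket xi Y).

Definition is_killing (g : riemannian_metric) xi : Prop :=
  forall X Y, lie_deriv_metric xi g X Y = 0.

Record almost_contact (g : riemannian_metric) := AlmostContact {
  ac_phi : {linear 'X(M) -> 'X(M)};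
  ac_xi : 'X(M);
  ac_eta : {scalar 'X(M)};
  ac_phi2 : forall X, ac_phi (ac_phi X) = - X + ac_eta X *: ac_xi;
  ac_eta_xi : ac_eta ac_xi = 1;
  ac_metric : forall X Y,
    g (ac_phi X) (ac_phi Y) = g X Y - ac_eta X * ac_eta Y
}.

Section AlmostContact.
Context {g : riemannian_metric} (S : almost_contact g).
Local Notation phi := (ac_phi S).

Definition fundamental_form X Y : 'Coo(M) := g X (phi Y).

Definition nijenhuis X Y : 'X(M) :=
  lie_bracket (phi X) (phi Y) + phi (phi (lie_bracket X Y))
  - phi (lie_bracket (phi X) Y) - phi (lie_bracket X (phi Y))
  + ext_d1 (ac_eta S) X Y *: ac_xi S.

Definition nijenhuis3 X Y Z : 'Coo(M) := g (nijenhuis X Y) Z.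

End AlmostContact.
End Tensors.

Arguments riemannian_metric {R m} M.

(* (i, j, k) is an even permutation of the three indices. *)
Definition even_perm3 (i j k : 'I_3) : Prop :=
  exists2 s : 'S_3, ~~ odd_perm s & [/\ i = s 0, j = s 1 & k = s (1 + 1)].

Record almost_3contact (R : realType) (n : nat) (M : manifold R (4 * n + 3)) :=
  Almost3Contact {
  a3c_metric : riemannian_metric M;
  a3c :> 'I_3 -> almost_contact a3c_metric;
  a3c_phi : forall i j k, even_perm3 i j k -> forall X : 'X(M),
    ac_phi (a3c k) X =
      ac_phi (a3c i) (ac_phi (a3c j) X) - ac_eta (a3c j) X *: ac_xi (a3c i) /\
    ac_phi (a3c k) X =
      - ac_phi (a3c j) (ac_phi (a3c i) X) + ac_eta (a3c i) X *: ac_xi (a3c j);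
  a3c_xi : forall i j k, even_perm3 i j k ->
    ac_xi (a3c k) = ac_phi (a3c i) (ac_xi (a3c j)) /\
    ac_xi (a3c k) = - ac_phi (a3c j) (ac_xi (a3c i));
  a3c_eta : forall i j k, even_perm3 i j k -> forall X : 'X(M),
    ac_eta (a3c k) X = ac_eta (a3c i) (ac_phi (a3c j) X) /\
    ac_eta (a3c k) X = - ac_eta (a3c j) (ac_phi (a3c i) X)
}.

Section Almost3Contact.
Context {R : realType} {n : nat} {M : manifold R (4 * n + 3)}.
Variable S : almost_3contact M.
Local Notation g := (a3c_metric S).
Local Notation phi i := (ac_phi (S i)).
Local Notation xi i := (ac_xi (S i)).
Local Notation eta i := (ac_eta (S i)).
Local Notation Phi i := (fundamental_form (S i)).

(* X is a section of the intersection of the kernels of the eta_i. *)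
Definition horizontal (X : 'X(M)) : Prop := forall i, eta i X = 0.

Definition is_3_alpha_delta_sasaki (alpha delta : R) : Prop :=
  alpha != 0 /\
  forall i j k, even_perm3 i j k -> forall X Y : 'X(M),
    ext_d1 (eta i) X Y =
      smooth_cst M (2 * alpha) * Phi i X Y
      + smooth_cst M (2 * (alpha - delta)) * wedge (eta j) (eta k) X Y.

Definition reeb_tensor (i j : 'I_3) (X Y : 'X(M)) : 'Coo(M) :=
  g (lie_deriv_endo (xi j) (phi i) X) Y
  + ext_d1 (eta j) X (phi i Y) + ext_d1 (eta j) (phi i X) Y.

Definition is_reeb_killing_function (beta : 'Coo(M)) : Prop :=
  (forall i X Y, horizontal X -> horizontal Y -> reeb_tensor i i X Y = 0) /\
  (forall i j k, even_perm3 i j k ->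
     forall X Y, horizontal X -> horizontal Y ->
       reeb_tensor i j X Y = beta * Phi k X Y /\
       - reeb_tensor j i X Y = beta * Phi k X Y).

Definition horizontally_skew (T : 'X(M) -> 'X(M) -> 'X(M) -> 'Coo(M)) : Prop :=
  forall X Y Z, horizontal X -> horizontal Y -> horizontal Z ->
    T Y X Z = - T X Y Z /\ T X Z Y = - T X Y Z.

Definition is_canonical : Prop :=
  [/\ forall i, horizontally_skew (nijenhuis3 (S i)),
      forall i, is_killing g (xi i),
      forall i j X Y Z, horizontal X -> horizontal Y -> horizontal Z ->
        nijenhuis3 (S i) X Y Z
          - ext_d2 (Phi i) (phi i X) (phi i Y) (phi i Z)
        = nijenhuis3 (S j) X Y Z
          - ext_d2 (Phi j) (phi j X) (phi j Y) (phi j Z)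
    & exists beta : 'Coo(M), is_reeb_killing_function beta].

End Almost3Contact.

(* Main.v *)
(* Cartan calculus reduces everything to algebra. From d eta_i one reads off
   L_{xi_i} eta_j = 2 delta eta_k and L_{xi_i} eta_k = - 2 delta eta_j; since
   Lie derivatives commute with d and alpha != 0, xi_i rotates (Phi_j, Phi_k)
   in the same way and fixes Phi_i. As phi_i is determined by Phi_j and Phi_k,
   it is invariant under xi_i, hence so is g: xi_i is Killing, and the Reeb
   tensors follow. From d (d eta_i) = 0 the Phi_i are closed on horizontal
   fields, so by Hitchin's lemma the Nijenhuis tensors vanish there, and the
   remaining conditions become 0 = 0. *)
Require Import Defs.
From mathcomp Require Import all_boot all_order all_fingroup all_algebra.
From mathcomp Require Import all_classical all_reals all_analysis.
From mathcomp Require Import ring.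
Set Implicit Arguments.
Unset Strict Implicit.
Unset Printing Implicit Defensive.
Import Order.TTheory GRing.Theory Num.Theory.
Import numFieldNormedType.Exports.
Local Open Scope ring_scope.

(** * Cartan calculus on derivations, and algebra of the metric *)

Section Calculus.
Context {R : realType} {m : nat} {M : manifold R m}.
Implicit Types (g : riemannian_metric M) (X Y Z v : 'X(M)) (f h : 'Coo(M)).
Implicit Types (phi : {linear 'X(M) -> 'X(M)}).
Implicit Types (eta zeta : 'X(M) -> 'Coo(M)) (w : 'X(M) -> 'X(M) -> 'Coo(M)).

Lemma vfD X f h : X (f + h) = X f + X h :> 'Coo(M).
Proof.
have /asboolP [Xl _] := vector_field_valP X.
by have := Xl 1 f h; rewrite smooth_cst1 !mul1r.
Qed.

Lemma vfM X f h : X (f * h) = X f * h + f * X h :> 'Coo(M).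
Proof. by have /asboolP [_ ->] := vector_field_valP X. Qed.

Lemma vf0 X : X 0 = 0 :> 'Coo(M).
Proof. by apply: (addIr (X 0 : 'Coo(M))); rewrite -vfD !add0r. Qed.

Lemma vfN X f : X (- f) = - X f :> 'Coo(M).
Proof. by apply: (addIr (X f : 'Coo(M))); rewrite -vfD !addNr vf0. Qed.

Lemma vf_cst X (a : R) : X (smooth_cst M a) = 0 :> 'Coo(M).
Proof.
have /asboolP [Xl _] := vector_field_valP X.
have X1 : X 1 = 0 :> 'Coo(M).
  by apply: (addIr (X 1 : 'Coo(M))); rewrite add0r -{3}(mulr1 1) vfM mulr1 mul1r.
by have := Xl a 1 0; rewrite X1 vf0 mulr1 mulr0 !addr0.
Qed.

Lemma vf1 X : X 1 = 0 :> 'Coo(M).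
Proof. by rewrite -smooth_cst1 vf_cst. Qed.

Lemma vf_ext X Y : (forall f, X f = Y f) -> X = Y.
Proof. by move=> XY; apply/val_inj/funext. Qed.

Lemma vf_cstZ X (a : R) f :
  X (smooth_cst M a * f) = smooth_cst M a * X f :> 'Coo(M).
Proof. by rewrite vfM vf_cst mul0r add0r. Qed.

Lemma lie_bracketE X Y f :
  lie_bracket X Y f = (X (Y f) : 'Coo(M)) - Y (X f) :> 'Coo(M).
Proof. by []. Qed.

Lemma lie_bracketC X Y : lie_bracket X Y = - lie_bracket Y X.
Proof. by apply: vf_ext => f; apply: esym (opprB _ _). Qed.

Lemma lie_bracketDr X Y Z :
  lie_bracket X (Y + Z) = lie_bracket X Y + lie_bracket X Z.
Proof.
apply: vf_ext => f.
rewrite lie_bracketE.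
rewrite [RHS](_ : _ = (lie_bracket X Y f : 'Coo(M)) + lie_bracket X Z f) //.
rewrite !lie_bracketE.
rewrite [X in X - _](_ : _ = X (Y f + Z f)) //.
rewrite [X in _ - X](_ : _ = (Y (X f) : 'Coo(M)) + Z (X f)) //.
rewrite vfD; ring.
Qed.

Lemma lie_bracketZr X f Y :
  lie_bracket X (f *: Y) = X f *: Y + f *: lie_bracket X Y.
Proof.
apply: vf_ext => h.
rewrite lie_bracketE [RHS](_ : _ = X f * Y h + f * lie_bracket X Y h) //.
rewrite lie_bracketE.
rewrite [X in X - _](_ : _ = X (f * Y h)) // [X in _ - X](_ : _ = f * Y (X h)) //.
rewrite vfM; ring.
Qed.

Lemma lie_bracketNr X Y : lie_bracket X (- Y) = - lie_bracket X Y.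
Proof. by rewrite -scaleN1r lie_bracketZr vfN vf1 oppr0 scale0r add0r scaleN1r. Qed.

Lemma jacobi X Y Z : lie_bracket X (lie_bracket Y Z) =
  lie_bracket (lie_bracket X Y) Z + lie_bracket Y (lie_bracket X Z).
Proof.
apply: vf_ext => f.
rewrite [RHS](_ : _ = (lie_bracket (lie_bracket X Y) Z f : 'Coo(M))
                     + lie_bracket Y (lie_bracket X Z) f) //.
rewrite !lie_bracketE !vfD !vfN; ring.
Qed.

(** Lie derivatives of covariant tensors. The forms are bare maps rather than bundled linear ones,
    so that [ext_d1 eta], [wedge] and explicit combinations can be inserted. *)
Definition lie1 v eta X : 'Coo(M) := v (eta X) - eta (lie_bracket v X).

Definition lie2 v w X Y : 'Coo(M) :=
  v (w X Y) - w (lie_bracket v X) Y - w X (lie_bracket v Y).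

(** Cartan's formula: the differential of [eta v] drops out because [eta v] is constant. *)
Lemma lie1_ext_d1 v eta X (a : R) :
  eta v = smooth_cst M a -> lie1 v eta X = ext_d1 eta v X.
Proof. by rewrite /lie1 /ext_d1 => ->; rewrite vf_cst subr0. Qed.

(** The Jacobi identity makes the Lie derivative commute with d. *)
Lemma lie2_ext_d1 v (eta : {scalar 'X(M)}) X Y :
  lie2 v (ext_d1 eta) X Y = ext_d1 (lie1 v eta) X Y.
Proof.
rewrite /lie2 /ext_d1 /lie1 (jacobi v X Y) (raddfD eta).
rewrite !(lie_bracketE v) !vfD !vfN; ring.
Qed.

(** Second derivatives cancel by the definition of the bracket, nested brackets by the Jacobi
    identity, to whose terms [J1] and [J2] bring them. *)
Lemma ext_d2_ext_d1 (eta : {scalar 'X(M)}) X Y Z : ext_d2 (ext_d1 eta) X Y Z = 0.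
Proof.
have := congr1 eta (jacobi X Y Z); rewrite raddfD /= => J.
have J1 : eta (lie_bracket (lie_bracket Y Z) X)
    = - eta (lie_bracket X (lie_bracket Y Z)).
  by rewrite lie_bracketC (raddfN eta).
have J2 : eta (lie_bracket (lie_bracket Z X) Y)
    = eta (lie_bracket Y (lie_bracket X Z)).
  rewrite lie_bracketC (raddfN eta) (lie_bracketC Z) lie_bracketNr.
  by rewrite (raddfN eta) opprK.
rewrite /ext_d2 /ext_d1 J1 J2 J !lie_bracketE (lie_bracketC Z X) (raddfN eta).
rewrite !vfD !vfN; ring.
Qed.

Lemma lie2_wedge v eta zeta X Y :
  lie2 v (wedge eta zeta) X Y
  = wedge (lie1 v eta) zeta X Y + wedge eta (lie1 v zeta) X Y.
Proof. rewrite /lie2 /wedge /lie1 vfD vfN !vfM; ring. Qed.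

Lemma ext_d1_cstZ (a : R) eta X Y :
  ext_d1 (fun Z => smooth_cst M a * eta Z) X Y = smooth_cst M a * ext_d1 eta X Y.
Proof. rewrite /ext_d1 !vf_cstZ; ring. Qed.

Lemma lie2_comb (a b : R) v w w' X Y :
  lie2 v (fun X Y => smooth_cst M a * w X Y + smooth_cst M b * w' X Y) X Y
  = smooth_cst M a * lie2 v w X Y + smooth_cst M b * lie2 v w' X Y.
Proof. rewrite /lie2 vfD !vf_cstZ; ring. Qed.

Lemma ext_d2_comb (a b : R) w w' X Y Z :
  ext_d2 (fun X Y => smooth_cst M a * w X Y + smooth_cst M b * w' X Y) X Y Z
  = smooth_cst M a * ext_d2 w X Y Z + smooth_cst M b * ext_d2 w' X Y Z.
Proof. rewrite /ext_d2 !vfD !vf_cstZ; ring. Qed.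

Lemma lie2_tensor v w eta zeta X Y :
  lie2 v (fun X Y => w X Y - eta X * zeta Y) X Y
  = lie2 v w X Y - lie1 v eta X * zeta Y - eta X * lie1 v zeta Y.
Proof. rewrite /lie2 /lie1 vfD vfN vfM; ring. Qed.

Lemma smooth_cstN (a : R) : smooth_cst M (- a) = - smooth_cst M a.
Proof. exact: val_inj. Qed.

Lemma smooth_cstB (a b : R) : smooth_cst M (a - b) = smooth_cst M a - smooth_cst M b.
Proof. exact: val_inj. Qed.

Lemma smooth_cstM (a b : R) : smooth_cst M (a * b) = smooth_cst M a * smooth_cst M b.
Proof. exact: val_inj. Qed.

(** Smooth functions need not form a domain, but a nonzero constant is a unit. *)
Lemma smooth_cst_mulI (a : R) : a != 0 -> injective ( *%R (smooth_cst M a)).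
Proof.
move=> a0 f h /(congr1 ( *%R (smooth_cst M a^-1))).
by rewrite !mulrA -smooth_cstM mulVf // smooth_cst1 !mul1r.
Qed.

Lemma smooth_sqr_eq0 f : f * f = 0 -> f = 0.
Proof.
move=> ff; apply/val_inj/funext => p; apply/eqP.
have /eqP := congr1 (fun h : 'Coo(M) => h p) ff.
by rewrite [X in X == _](_ : _ = f p * f p) // mulf_eq0 orbb.
Qed.

Lemma metricDl g X Y Z : g (X + Y) Z = g X Z + g Y Z.
Proof. by have := metric_linear g Z 1 X Y; rewrite scale1r mul1r. Qed.

Lemma metric0l g Z : g 0 Z = 0.
Proof. by apply: (addIr (g 0 Z)); rewrite -metricDl !add0r. Qed.

Lemma metricZl g f X Z : g (f *: X) Z = f * g X Z.
Proof. by have := metric_linear g Z f X 0; rewrite metric0l !addr0. Qed.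

Lemma metricNl g X Z : g (- X) Z = - g X Z.
Proof. by rewrite -scaleN1r metricZl mulN1r. Qed.

Lemma metricDr g X Y Z : g X (Y + Z) = g X Y + g X Z.
Proof. by rewrite !(Defs.metric_sym g X) metricDl. Qed.

Lemma metricZr g f X Z : g X (f *: Z) = f * g X Z.
Proof. by rewrite !(Defs.metric_sym g X) metricZl. Qed.

Lemma metricNr g X Z : g X (- Z) = - g X Z.
Proof. by rewrite !(Defs.metric_sym g X) metricNl. Qed.

(** Positivity at a point where [X] acts nontrivially would contradict [g X X = 0]. *)
Lemma metric_nondegenerate g X : (forall Y, g X Y = 0) -> X = 0.
Proof.
move=> gX0; apply: vf_ext => f; apply/val_inj/funext => p.
rewrite [RHS](_ : _ = 0 :> R) //.
apply/eqP/negPn/negP => Xfp.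
have := metric_pos g (p := p) (ex_intro _ f Xfp).
by rewrite gX0 [X in _ < X](_ : _ = 0) // ltxx.
Qed.

Lemma lie2_comp_l v w phi X Y : (forall X X' Y, w (X - X') Y = w X Y - w X' Y) ->
  lie2 v (fun X Y => w (phi X) Y) X Y
  = lie2 v w (phi X) Y + w (lie_deriv_endo v phi X) Y.
Proof. by move=> wB; rewrite /lie2 /lie_deriv_endo wB; ring. Qed.

End Calculus.

(** * Identities of a single almost contact metric structure *)

Section AlmostContact.
Context {R : realType} {m : nat} {M : manifold R m} {g : riemannian_metric M}.
Variable S : almost_contact g.
Implicit Types X Y Z v : 'X(M).
Local Notation phi := (ac_phi S).
Local Notation xi := (ac_xi S).
Local Notation eta := (ac_eta S).
Local Notation Phi := (fundamental_form S).

Lemma etaZ (f : 'Coo(M)) X : eta (f *: X) = f * eta X.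
Proof. by rewrite linearZ. Qed.

(** Since [phi (phi xi) = 0], the field [phi xi] equals [c *: xi] with [c = eta (phi xi)]. Applying
    [phi] again gives [c * c = 0], and the ring of smooth functions is reduced. *)
Lemma ac_phi_xi : phi xi = 0.
Proof.
have p2 : phi (phi xi) = 0 by rewrite ac_phi2 ac_eta_xi scale1r addNr.
have p1 : phi xi = eta (phi xi) *: xi.
  have := ac_phi2 S (phi xi); rewrite p2 raddf0 => /eqP.
  by rewrite addrC eq_sym subr_eq0 => /eqP.
have c0 : eta (phi xi) = 0.
  apply: smooth_sqr_eq0.
  rewrite -{2}(mulr1 (eta (phi xi))) -(ac_eta_xi S) -!etaZ -p1 -linearZ -p1.
  by rewrite p2 raddf0.
by rewrite p1 c0 scale0r.
Qed.

Lemma ac_metric_xi X : g X xi = eta X.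
Proof.
have := ac_metric S X xi.
rewrite ac_phi_xi ac_eta_xi mulr1 Defs.metric_sym metric0l => /eqP.
by rewrite eq_sym subr_eq0 => /eqP.
Qed.

(** Compare [phi^2] applied to [phi X] with [phi] applied to [phi^2 X]. *)
Lemma ac_eta_phi X : eta (phi X) = 0.
Proof.
have := ac_phi2 S (phi X).
rewrite (ac_phi2 S X) raddfD raddfN /= linearZ /= ac_phi_xi scaler0 addr0 -[LHS]addr0.
move=> /addrI/(congr1 eta).
by rewrite etaZ ac_eta_xi mulr1 raddf0.
Qed.

Lemma ac_metric_phil X Y : g (phi X) Y = - g X (phi Y).
Proof.
have := ac_metric S X (phi Y).
rewrite ac_eta_phi mulr0 subr0 ac_phi2 metricDr metricNr metricZr ac_metric_xi.
by rewrite ac_eta_phi mulr0 addr0 => <-; rewrite opprK.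
Qed.

Lemma fundamental_formC X Y : Phi X Y = - Phi Y X.
Proof. by rewrite /fundamental_form Defs.metric_sym ac_metric_phil. Qed.

Lemma fundamental_formDl X Y Z : Phi (X + Y) Z = Phi X Z + Phi Y Z.
Proof. exact: metricDl. Qed.

Lemma fundamental_formNl X Z : Phi (- X) Z = - Phi X Z.
Proof. exact: metricNl. Qed.

Lemma fundamental_formBl X Y Z : Phi (X - Y) Z = Phi X Z - Phi Y Z.
Proof. by rewrite fundamental_formDl fundamental_formNl. Qed.

Lemma lie2_fundamental v X Y : lie2 v Phi X Y
  = lie_deriv_metric v g X (phi Y) + g X (lie_deriv_endo v phi Y).
Proof.
rewrite /lie2 /lie_deriv_metric /lie_deriv_endo /fundamental_form metricDr metricNr.
ring.
Qed.

(** With [phi] and [Phi] invariant, the Lie derivative of [g] vanishes at [X] and [phi (phi Y)],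
    that is, at [X] and [- Y + eta Y *: xi]. As [g X xi = eta X], invariance of [eta] disposes of
    the [xi] part. *)
Lemma xi_killing : (forall X, lie1 xi eta X = 0) ->
  (forall X, lie_deriv_endo xi phi X = 0) ->
  (forall X Y, lie2 xi Phi X Y = 0) -> is_killing g xi.
Proof.
move=> Leta Lphi LPhi X Y.
have := LPhi X (phi Y); rewrite lie2_fundamental Lphi.
rewrite Defs.metric_sym metric0l addr0 ac_phi2 /lie_deriv_metric.
rewrite lie_bracketDr lie_bracketNr lie_bracketZr.
have -> : lie_bracket xi xi = 0 by apply: vf_ext => f; apply: subrr.
rewrite scaler0 addr0 !metricDr !metricNr !metricZr !ac_metric_xi vfD vfN vfM => LgX.
have /subr0_eq LX := Leta X.
by rewrite -[LHS]opprK -[RHS]oppr0 -LgX LX; ring.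
Qed.

End AlmostContact.

(** * Even permutations of the three indices *)

Lemma even_perm3_rot (i j k : 'I_3) : even_perm3 i j k -> even_perm3 j k i.
Proof.
case=> s evs [-> -> ->].
(* [c] is the cycle 0 -> 1 -> 2 -> 0, even as a product of two transpositions. *)
pose t (a b : 'I_3) := tperm a b; pose c : 'S_3 := (t 0 1%R * t 0 (1 + 1)%R)%g.
exists (c * s)%g; first by rewrite !odd_permM !odd_tperm.
by split; rewrite /c /t !permM; congr (s _); rewrite !permE.
Qed.

(** Completes a single index to a frame, and splits claims about all indices, such as horizontality,
    into three cases. *)
Lemma even_perm3_cover (i : 'I_3) : exists j k, even_perm3 i j k /\
  (forall l, [\/ l = i, l = j | l = k]).
Proof.
have e012 : even_perm3 0 1 (1 + 1).
  by exists 1%g; [rewrite odd_perm1 | rewrite !perm1].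
have cover (l : 'I_3) : [\/ l = 0, l = 1 | l = 1 + 1].
  by case: l => [[|[|[|//]]] ?]; [apply: Or31|apply: Or32|apply: Or33]; exact: val_inj.
case: (cover i) => ->.
- by exists 1, (1 + 1).
- exists (1 + 1), 0; split; first exact: even_perm3_rot.
  by move=> l; case: (cover l) => ->; [exact: Or33|exact: Or31|exact: Or32].
- exists 0, 1; split; first exact/even_perm3_rot/even_perm3_rot.
  by move=> l; case: (cover l) => ->; [exact: Or32|exact: Or33|exact: Or31].
Qed.

(** * Almost 3-contact algebra and horizontal integrability *)

Section Almost3Contact.
Context {R : realType} {n : nat} {M : manifold R (4 * n + 3)}.
Variable S : almost_3contact M.
Implicit Types X Y Z : 'X(M).
Local Notation g := (a3c_metric S).
Local Notation phi i := (ac_phi (S i)).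
Local Notation xi i := (ac_xi (S i)).
Local Notation eta i := (ac_eta (S i)).
Local Notation Phi i := (fundamental_form (S i)).

Section Frame.
Variables (i j k : 'I_3).
Hypothesis ijk : even_perm3 i j k.

Lemma a3c_phi_ij X : phi i (phi j X) = phi k X + eta j X *: xi i.
Proof. by have [-> _] := a3c_phi S ijk X; rewrite subrK. Qed.

Lemma a3c_phi_ji X : phi j (phi i X) = - phi k X + eta i X *: xi j.
Proof. by have [_ ->] := a3c_phi S ijk X; rewrite opprD opprK addrNK. Qed.

Lemma a3c_eta_ij X : eta i (phi j X) = eta k X.
Proof. by have [<- _] := a3c_eta S ijk X. Qed.

Lemma a3c_eta_ji X : eta j (phi i X) = - eta k X.
Proof. by have [_ ->] := a3c_eta S ijk X; rewrite opprK. Qed.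

Lemma a3c_xi_ij : phi i (xi j) = xi k.
Proof. by have [<- _] := a3c_xi S ijk. Qed.

Lemma a3c_xi_ji : phi j (xi i) = - xi k.
Proof. by have [_ ->] := a3c_xi S ijk; rewrite opprK. Qed.

Lemma a3c_eta_xi_k : eta i (xi k) = 0 /\ eta j (xi k) = 0.
Proof.
have [xk xk'] := a3c_xi S ijk.
by rewrite {1}xk xk' raddfN /= !ac_eta_phi oppr0.
Qed.

(** Together with [fundamental_form_ji], this expresses how [phi i] exchanges [Phi j] and [Phi k] up
    to sign; the corrections vanish when either argument is horizontal. *)
Lemma fundamental_form_ki X Y :
  Phi k (phi i X) Y = Phi j X Y - eta i X * eta k Y.
Proof.
have jE := a3c_phi S (even_perm3_rot (even_perm3_rot ijk)) Y.
rewrite /fundamental_form ac_metric_phil -metricNr jE.2.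
by rewrite metricDr metricZr ac_metric_xi; ring.
Qed.

Lemma fundamental_form_ji X Y :
  Phi j (phi i X) Y = - Phi k X Y - eta i X * eta j Y.
Proof.
rewrite /fundamental_form ac_metric_phil a3c_phi_ij metricDr metricZr ac_metric_xi.
ring.
Qed.

End Frame.

Lemma horizontal_phi i X : horizontal S X -> horizontal S (phi i X).
Proof.
move=> hX l; have [j [k [ijk /(_ l)]]] := even_perm3_cover i.
case=> ->; first exact: ac_eta_phi.
  by rewrite (a3c_eta_ji ijk) hX oppr0.
by rewrite (a3c_eta_ij (even_perm3_rot (even_perm3_rot ijk))) hX.
Qed.

(** Brackets of horizontal fields need not be horizontal, but every wedge in the formula keeps one
    horizontal argument, which kills it. *)
Lemma ext_d2_wedge_horizontal i j X Y Z :
  horizontal S X -> horizontal S Y -> horizontal S Z ->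
  ext_d2 (wedge (eta i) (eta j)) X Y Z = 0.
Proof.
move=> hX hY hZ; rewrite /ext_d2 /wedge !hX !hY !hZ !(mulr0, mul0r).
by rewrite !subrr !vf0 !subr0 !addr0.
Qed.

(* Hitchin's argument for hyperkaehler structures: if two of the three
   fundamental forms are closed, the third structure is integrable.
   Here Phi_j (phi_i X) = - Phi_k X and Phi_k (phi_i X) = Phi_j X horizontally,
   so Phi_j (N_i (X, Y)) is a combination of values of dPhi_j and dPhi_k. *)
Lemma nijenhuis_horizontal i j k : even_perm3 i j k ->
  (forall l X Y Z, horizontal S X -> horizontal S Y -> horizontal S Z ->
     ext_d2 (Phi l) X Y Z = 0) ->
  forall X Y Z, horizontal S X -> horizontal S Y -> horizontal S Z ->
    nijenhuis3 (S i) X Y Z = 0.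
Proof.
move=> ijk dPhi X Y Z hX hY.
have hphi l W := @horizontal_phi l W.
(* Taking [phi j Z] for [W] recovers the metric, as [phi j (phi j Z) = - Z] for horizontal [Z]. *)
suff main W : horizontal S W -> Phi j (nijenhuis (S i) X Y) W = 0.
  move=> hZ; have := main (phi j Z) (hphi _ _ hZ).
  rewrite /fundamental_form ac_phi2 hZ scale0r addr0 metricNr.
  by move/eqP; rewrite oppr_eq0 => /eqP.
move=> hW.
(* In these four rules [U] stays arbitrary, because it will also be a Lie bracket. *)
have ki U V : horizontal S V -> Phi k (phi i U) V = Phi j U V.
  by move=> hV; rewrite (fundamental_form_ki ijk) hV mulr0 subr0.
have ji U V : horizontal S V -> Phi j (phi i U) V = - Phi k U V.
  by move=> hV; rewrite (fundamental_form_ji ijk) hV mulr0 subr0.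
have ki' U V : horizontal S V -> Phi k U (phi i V) = Phi j U V.
  move=> hV; rewrite fundamental_formC (fundamental_form_ki ijk) hV mul0r subr0.
  by rewrite -fundamental_formC.
have ji' U V : horizontal S V -> Phi j U (phi i V) = - Phi k U V.
  move=> hV; rewrite fundamental_formC (fundamental_form_ji ijk) hV mul0r subr0.
  by rewrite -fundamental_formC.
have zero_xi V : Phi j (V *: xi i) W = 0.
  by rewrite /fundamental_form metricZl Defs.metric_sym ac_metric_xi hphi ?mulr0.
have d1 := dPhi j _ _ _ (hphi i _ hX) (hphi i _ hY) hW.
have d2 := dPhi j _ _ _ hX hY hW.
have d3 := dPhi k _ _ _ hX (hphi i _ hY) hW.
have d4 := dPhi k _ _ _ (hphi i _ hX) hY hW.
rewrite /nijenhuis ac_phi2 !fundamental_formDl !fundamental_formNl.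
rewrite !zero_xi !ji //.
(* The brackets of the first two arguments in these four terms reproduce [Phi j] of the Nijenhuis
   tensor. Derivatives and brackets with [W] cancel once [phi i] is moved out. *)
transitivity (- ext_d2 (Phi j) (phi i X) (phi i Y) W + ext_d2 (Phi j) X Y W
  - ext_d2 (Phi k) X (phi i Y) W - ext_d2 (Phi k) (phi i X) Y W); last first.
  by rewrite d1 d2 d3 d4; ring.
rewrite /ext_d2.
rewrite !(ji', ki') //; try exact: hphi.
rewrite !(ji, ki) // !vfN.
ring.
Qed.

(** * Consequences of the 3-(alpha, delta)-Sasaki equation *)

Section Sasaki.
Variables alpha delta : R.
Hypothesis sasaki : is_3_alpha_delta_sasaki S alpha delta.

Local Notation a := (smooth_cst M (2 * alpha)).
Local Notation c := (smooth_cst M (2 * (alpha - delta))).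
Local Notation d := (smooth_cst M (2 * delta)).

Lemma smooth_cst_2delta : d = a - c.
Proof. by rewrite -smooth_cstB; congr smooth_cst; ring. Qed.

Lemma smooth_cst_2alpha_inj : injective ( *%R a).
Proof. by apply: smooth_cst_mulI; rewrite mulf_neq0 ?pnatr_eq0 //; case: sasaki. Qed.

Lemma sasaki_ext_d1 i j k : even_perm3 i j k ->
  ext_d1 (eta i) = fun X Y => a * Phi i X Y + c * wedge (eta j) (eta k) X Y.
Proof. by move=> ijk; apply/funext => X; apply/funext => Y; apply: sasaki.2. Qed.

Section SasakiFrame.
Variables (i j k : 'I_3).
Hypothesis ijk : even_perm3 i j k.

Let jki := even_perm3_rot ijk.
Let kij := even_perm3_rot jki.

Lemma lie1_xi_eta_i : lie1 (xi i) (eta i) = fun=> 0.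
Proof.
apply/funext => X.
rewrite (lie1_ext_d1 _ (a := 1)) ?ac_eta_xi ?smooth_cst1 // (sasaki_ext_d1 ijk).
rewrite fundamental_formC /fundamental_form ac_phi_xi Defs.metric_sym metric0l.
rewrite /wedge (a3c_eta_xi_k jki).1 (a3c_eta_xi_k jki).2; ring.
Qed.

(** By Cartan's formula this is [ext_d1 (eta j) (xi i) X]: the [Phi j] term contributes
    [a * eta k X], the wedge [- c * eta k X]. *)
Lemma lie1_xi_eta_j : lie1 (xi i) (eta j) = fun X => d * eta k X.
Proof.
apply/funext => X.
rewrite (lie1_ext_d1 _ (a := 0)); last first.
  by rewrite (a3c_eta_xi_k jki).1; exact: val_inj.
rewrite (sasaki_ext_d1 jki) fundamental_formC /fundamental_form (a3c_xi_ji ijk).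
rewrite metricNr ac_metric_xi /wedge ac_eta_xi (a3c_eta_xi_k jki).2.
by rewrite smooth_cst_2delta; ring.
Qed.

Lemma lie1_xi_eta_k : lie1 (xi i) (eta k) = fun X => - (d * eta j X).
Proof.
apply/funext => X.
rewrite (lie1_ext_d1 _ (a := 0)); last first.
  by rewrite (a3c_eta_xi_k jki).2; exact: val_inj.
rewrite (sasaki_ext_d1 kij) fundamental_formC /fundamental_form (a3c_xi_ij kij).
rewrite ac_metric_xi /wedge ac_eta_xi (a3c_eta_xi_k jki).1.
by rewrite smooth_cst_2delta; ring.
Qed.

(** Lie-derive the Sasaki equation for [eta i]: the left side vanishes, and [wedge (eta j) (eta k)]
    is invariant under the rotation of its factors. *)
Lemma lie2_xi_Phi_i X Y : lie2 (xi i) (Phi i) X Y = 0.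
Proof.
apply: smooth_cst_2alpha_inj; have := lie2_ext_d1 (xi i) (eta i) X Y.
rewrite lie1_xi_eta_i (sasaki_ext_d1 ijk) lie2_comb lie2_wedge.
rewrite lie1_xi_eta_j lie1_xi_eta_k /wedge /ext_d1 !vf0 !subr0.
by rewrite [X in c * X](_ : _ = 0) ?mulr0 ?addr0 //; ring.
Qed.

(** Lie-derive the equation for [eta j] and expand d of [d * eta k] by the equation for [eta k]. The
    wedge terms of both sides agree and are cancelled in their unfolded form. *)
Lemma lie2_xi_Phi_j X Y : lie2 (xi i) (Phi j) X Y = d * Phi k X Y.
Proof.
apply: smooth_cst_2alpha_inj; have := lie2_ext_d1 (xi i) (eta j) X Y.
rewrite lie1_xi_eta_j ext_d1_cstZ (sasaki_ext_d1 jki) (sasaki_ext_d1 kij).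
rewrite lie2_comb lie2_wedge lie1_xi_eta_k lie1_xi_eta_i /wedge => E.
by apply: (addIr (c * (- (d * eta j X) * eta i Y - - (d * eta j Y) * eta i X
  + (eta k X * 0 - eta k Y * 0)))); rewrite E; ring.
Qed.

Lemma lie2_xi_Phi_k X Y : lie2 (xi i) (Phi k) X Y = - (d * Phi j X Y).
Proof.
apply: smooth_cst_2alpha_inj; have := lie2_ext_d1 (xi i) (eta k) X Y.
(* The sign moves into the constant so that [ext_d1_cstZ] applies. *)
have -> : lie1 (xi i) (eta k) = fun X => smooth_cst M (- (2 * delta)) * eta j X.
  by rewrite lie1_xi_eta_k; apply/funext => Z; rewrite smooth_cstN mulNr.
rewrite ext_d1_cstZ (sasaki_ext_d1 jki) (sasaki_ext_d1 kij).
rewrite smooth_cstN lie2_comb lie2_wedge lie1_xi_eta_j lie1_xi_eta_i /wedge => E.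
by apply: (addIr (c * (0 * eta j Y - 0 * eta j X
  + (eta i X * (d * eta k Y) - eta i Y * (d * eta k X))))); rewrite E; ring.
Qed.

(* Lie-deriving Phi_k (phi_i X) = Phi_j X - eta_i X * eta_k along xi_i shows
   that V = (L_{xi_i} phi_i) X is in the kernel of Phi_k, hence proportional to
   xi_k; its eta_k-component vanishes because eta_k (phi_i X) = eta_j X. *)
Lemma lie_deriv_xi_phi X : lie_deriv_endo (xi i) (phi i) X = 0.
Proof.
set V := lie_deriv_endo _ _ _.
have VPhi Y : Phi k V Y = 0.
  have := lie2_comp_l (xi i) (phi i) X Y (fundamental_formBl (S k)).
  rewrite lie2_xi_Phi_k (fundamental_form_ji ijk) -/V.
  rewrite [X in lie2 _ X](_ : _ = fun U W => Phi j U W - eta i U * eta k W);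
    last by do 2!apply/funext => ?; exact: fundamental_form_ki.
  rewrite lie2_tensor lie2_xi_Phi_j lie1_xi_eta_i lie1_xi_eta_k => E.
  apply: (addrI (- (d * (- Phi k X Y - eta i X * eta j Y)))).
  by rewrite -E; ring.
have phiV : phi k V = 0.
  apply: (@metric_nondegenerate _ _ _ g) => Y.
  by rewrite ac_metric_phil -[g _ _]/(Phi k V Y) VPhi oppr0.
have etaV : eta k V = 0.
  rewrite /V /lie_deriv_endo raddfB /=.
  have := congr1 (fun f => f (phi i X)) lie1_xi_eta_k.
  rewrite /lie1 !(a3c_eta_ij kij) (a3c_eta_ji ijk) => E.
  have := congr1 (fun f => f X) lie1_xi_eta_j; rewrite /lie1 => E'.
  apply/eqP; rewrite subr_eq0; apply/eqP.
  apply: oppr_inj; apply: (addrI (xi i (eta j X) : 'Coo(M))).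
  by rewrite E E'; ring.
have := ac_phi2 (S k) V; rewrite phiV etaV raddf0 scale0r addr0.
by move=> /esym/eqP; rewrite oppr_eq0 => /eqP.
Qed.

Lemma sasaki_killing : is_killing g (xi i).
Proof.
apply: xi_killing; [|exact: lie_deriv_xi_phi|exact: lie2_xi_Phi_i].
by move=> X; rewrite lie1_xi_eta_i.
Qed.

Lemma sasaki_dPhi X Y Z : horizontal S X -> horizontal S Y -> horizontal S Z ->
  ext_d2 (Phi i) X Y Z = 0.
Proof.
move=> hX hY hZ; apply: smooth_cst_2alpha_inj.
have := ext_d2_ext_d1 (eta i) X Y Z; rewrite (sasaki_ext_d1 ijk) ext_d2_comb.
by rewrite ext_d2_wedge_horizontal // !mulr0 addr0.
Qed.

(** [phi i] is invariant, and the two [ext_d1] terms cancel because [phi i] is skew for [g]. *)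
Lemma reeb_tensor_ii X Y : horizontal S X -> horizontal S Y ->
  reeb_tensor S i i X Y = 0.
Proof.
move=> hX hY; rewrite /reeb_tensor lie_deriv_xi_phi metric0l (sasaki_ext_d1 ijk).
have hphi l W := @horizontal_phi l W.
rewrite /wedge !hX !hY !hphi // /fundamental_form ac_metric_phil; ring.
Qed.

End SasakiFrame.

(** Reduces the first term of the Reeb tensors to the known Lie derivatives of the [Phi i]. *)
Lemma metric_lie_deriv_endo i v X Y : is_killing g v ->
  g (lie_deriv_endo v (phi i) X) Y = lie2 v (Phi i) Y X.
Proof. by move=> kv; rewrite lie2_fundamental kv add0r Defs.metric_sym. Qed.

(** The Lie derivative of [phi i] contributes [d], and each of the two [ext_d1] terms contributes
    [- a], since horizontally [phi i] and [phi j] compose to [phi k] up to sign. *)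
Lemma reeb_tensor_ij i j k X Y : even_perm3 i j k ->
  horizontal S X -> horizontal S Y ->
  reeb_tensor S i j X Y = (d - a - a) * Phi k X Y /\
  - reeb_tensor S j i X Y = (d - a - a) * Phi k X Y.
Proof.
move=> ijk hX hY; have jki := even_perm3_rot ijk.
have hphi l W := @horizontal_phi l W.
rewrite /reeb_tensor !metric_lie_deriv_endo //;
  [|exact: (sasaki_killing ijk)|exact: (sasaki_killing jki)].
rewrite (lie2_xi_Phi_k jki) (lie2_xi_Phi_j ijk) (sasaki_ext_d1 ijk) (sasaki_ext_d1 jki).
rewrite (fundamental_formC _ Y X) /wedge !hX !hY !hphi //.
rewrite /fundamental_form !ac_metric_phil (a3c_phi_ij ijk) (a3c_phi_ji ijk) !hY.
rewrite !scale0r !addr0 metricNr; split; ring.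
Qed.

End Sasaki.
End Almost3Contact.

Theorem corollary2p3p3 (R : realType) (alpha delta : R) (n : nat)
    (M : manifold R (4 * n + 3)) (S : almost_3contact M) :
  alpha != 0 -> is_3_alpha_delta_sasaki S alpha delta ->
  is_canonical S /\
  is_reeb_killing_function S (smooth_cst M (2 * (delta - 2 * alpha))).
Proof.
move=> _ sasaki.
have dPhi l X Y Z : horizontal S X -> horizontal S Y -> horizontal S Z ->
    ext_d2 (fundamental_form (S l)) X Y Z = 0.
  have [j [k [ljk _]]] := even_perm3_cover l.
  by move=> hX hY hZ; exact: (sasaki_dPhi sasaki ljk hX hY hZ).
have N0 l X Y Z : horizontal S X -> horizontal S Y -> horizontal S Z ->
    nijenhuis3 (S l) X Y Z = 0.
  by have [j [k [ljk _]]] := even_perm3_cover l;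
    apply: nijenhuis_horizontal ljk dPhi _ _ _.
have reeb : is_reeb_killing_function S (smooth_cst M (2 * (delta - 2 * alpha))).
  split=> [l|i j k ijk] X Y hX hY.
    by have [j [k [ljk _]]] := even_perm3_cover l;
      exact: (reeb_tensor_ii sasaki ljk hX hY).
  (* Here 2 (delta - 2 alpha) is split as 2 delta - 2 alpha - 2 alpha. *)
  rewrite [smooth_cst M _](_ : _ = smooth_cst M (2 * delta)
    - smooth_cst M (2 * alpha) - smooth_cst M (2 * alpha)).
    exact: (reeb_tensor_ij sasaki ijk hX hY).
  by rewrite -!smooth_cstB; congr smooth_cst; ring.
split=> //; split.
- by move=> l X Y Z hX hY hZ; rewrite !N0 // oppr0.
- by move=> l; have [j [k [ljk _]]] := even_perm3_cover l;
    exact: (sasaki_killing sasaki ljk).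
- by move=> i j X Y Z hX hY hZ; rewrite !N0 // !dPhi //; exact: horizontal_phi.
- by eexists; exact: reeb.
Qed.
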